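(* Let $n$ and $d$ be positive integers with $d\ge 2n-1$. Let $(t_{0\bmod 2n},\dots,t_{n-1\bmod 2n})\in\mathbb{C}^n$ be arbitrary, and put $t_{n+\nu\bmod 2n}=-t_{\nu\bmod 2n}$ for $\nu=0,\dots,n-1$. Then, for every polynomial $f=\sum_\nu a_\nu X^\nu\in\mathbb{C}[X]$ of degree $<d$ with $\|f\|_\infty\le 1$, one has $$\left|\sum_{\nu=0}^{d-1}t_{\nu\bmod 2n}\,a_\nu\right|\le\frac1n\sum_{\omega^n=-1}\left|\sum_{\nu=0}^{n-1}\frac{t_{\nu\bmod 2n}}{\omega^\nu}\right|.$$ Moreover, there is a polynomial $f\in\mathbb{C}[X]$ of degree $<d$ with $\|f\|_\infty\le 1$ for which equality is attained in this inequality; in fact, this $f$ may even be chosen to have degree $\le 2n-2$.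
   Context: For a function $f$ on the open complex unit disk $\mathbb{D}$, $\|f\|_\infty=\sup\{|f(z)|: z\in\mathbb{D}\}$. The numbers $t_{\nu\bmod 2n}$ are indexed by residue classes modulo $2n$, so $t_{\nu\bmod 2n}$ depends only on $\nu$ modulo $2n$. The sum $\sum_{\omega^n=-1}$ ranges over all complex numbers $\omega$ with $\omega^n=-1$. *)

(* Defs.v *)
From HB Require Import structures.
From mathcomp Require Import all_boot all_order all_algebra.
From mathcomp Require Import complex.
From mathcomp Require Import boolp classical_sets fsbigop reals ereal.

Set Implicit Arguments.
Unset Strict Implicit.
Unset Printing Implicit Defensive.

Import Order.TTheory GRing.Theory Num.Theory.

Local Open Scope classical_set_scope.
Local Open Scope ring_scope.

(* In [R[i]] the modulus [`|f z|] has type [R[i]] but is real, so taking its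
   real part loses nothing.  The supremum is an extended real: it is [+oo] when
   [f] is unbounded on the disk. *)
Definition disk_supnorm (R : realType) (f : R[i] -> R[i]) : \bar R :=
  ereal_sup [set (complex.Re `|f z|)%:E | z in [set z : R[i] | `|z| < 1]].

(* Main.v *)
Require Import Defs.
From HB Require Import structures.
From mathcomp Require Import all_boot all_order all_algebra.
From mathcomp Require Import complex.
From mathcomp Require Import boolp classical_sets fsbigop reals ereal.
From mathcomp Require Import separable cyclotomic.

Set Implicit Arguments.
Unset Strict Implicit.
Unset Printing Implicit Defensive.

Import Order.TTheory GRing.Theory Num.Theory.

Local Open Scope classical_set_scope.
Local Open Scope ring_scope.

(** The sequence [t] is antiperiodic with period [n], and so are the sequences
    [nu |-> w ^+ nu] for the [n] roots [w] of [X^n + 1].  Finite Fourier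
    inversion expands [t] in these:
      [t nu = \sum_w c w * w ^+ nu]  with
      [c w = n^-1 * \sum_(l < n) t l / w ^+ l].
    Hence the functional [f |-> \sum_nu t nu * f`_nu] equals
    [f |-> \sum_w c w * f.[w]] ([antiperiodic_fourier], [sum_coef_fourier]).
    The roots [w] lie on the unit circle, where [|f|] is still at most [1] by
    continuity ([horner_boundary_le]), so the functional is bounded by
    [\sum_w |c w|], which is the right-hand side.

    Equality holds as soon as [f] takes at each [w] a value of modulus at most
    [1] that turns [c w] into [|c w|].  Such an [f], of degree at most [2n-2]
    and bounded by [1] on the disk, comes from Fejer interpolation
    ([bounded_interpolation]).  Put
    [D_w(z) = n^-1 * \sum_(k < n) (z / w) ^+ k] and [f = \sum_w e w * D_w ^+ 2].
    Then [D_w] is [1] at [w] and [0] at the other roots, so [f.[w] = e w], while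
    Parseval's identity gives, for [|z| <= 1],
      [\sum_w |D_w(z)|^2 = n^-1 * \sum_(k < n) |z|^(2k) <= 1],
    so that [|f| <= 1] on the disk when all [|e w| <= 1]. *)

(** * Fourier analysis on the roots of [X^n + 1] *)

Lemma sum_expr_unity_root (F : fieldType) (n : nat) (x : F) :
  x ^+ n = 1 -> x != 1 -> \sum_(k < n) x ^+ k = 0.
Proof.
move=> xn1 x_neq1; apply: (mulfI (x := x - 1)); first by rewrite subr_eq0.
by rewrite -subrX1 xn1 subrr mulr0.
Qed.

(** [X^n + 1] has [n] distinct roots because it divides the separable
    polynomial [X^(2n) - 1]. *)
Lemma roots_XnD1 (C : numClosedFieldType) (n : nat) : (0 < n)%N ->
  exists2 w : 'I_n -> C, injective w &
    forall x, x ^+ n = -1 <-> exists j, x = w j.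
Proof.
move=> n_gt0; have monp : ('X^n + 1 : {poly C}) \is monic.
  by rewrite -(opprK 1) -polyCN monicXnsubC.
have [r Dp] := closed_field_poly_normal ('X^n + 1 : {poly C}).
rewrite (monicP monp) scale1r in Dp.
have uniq_r : uniq r.
  have: separable_poly ('X^(2 * n) - 1 : {poly C}).
    by apply: separable_Xn_sub_1; rewrite pnatr_eq0 -lt0n muln_gt0.
  rewrite mulnC exprM subr_sqr_1 separable_mul => /and3P[_ + _].
  by rewrite Dp separable_prod_XsubC.
have size_r : size r = n.
  apply: succn_inj; rewrite -(size_prod_XsubC r id) -Dp.
  by rewrite -(opprK 1) -polyCN size_XnsubC.
have mem_r x : (x ^+ n = -1) <-> (x \in r).
  rewrite -root_prod_XsubC -Dp /root !hornerE addr_eq0.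
  by split=> [->|/eqP].
exists (fun j : 'I_n => r`_j) => [i j /eqP|x].
  by rewrite nth_uniq ?size_r // => /eqP/val_inj.
rewrite mem_r; split=> [rx|[j ->]]; last by rewrite mem_nth ?size_r.
have jP : (index x r < n)%N by rewrite -size_r index_mem.
by exists (Ordinal jP); rewrite /= nth_index.
Qed.

Section RootFamily.

Variables (F : fieldType) (n : nat) (c : F) (w : 'I_n -> F).
Hypotheses (n_neq0 : n%:R != 0 :> F) (c_neq0 : c != 0).
Hypotheses (w_inj : injective w) (wn : forall j, w j ^+ n = c).

Lemma root_neq0 j : w j != 0.
Proof.
apply: contraNneq c_neq0 => wj0; rewrite -(wn j) wj0 expr0n.
by case: (n =P 0%N) n_neq0 => [-> | _ _]; rewrite eqxx.
Qed.

Lemma sum_expr_root_ratio i j :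
  \sum_(k < n) (w i / w j) ^+ k = n%:R *+ (i == j).
Proof.
case: eqVneq => [<-|neq_ij]; last first.
  apply: sum_expr_unity_root; first by rewrite expr_div_n !wn divff.
  apply: contraNneq neq_ij => /(congr1 ( *%R^~ (w j))).
  by rewrite divfK ?root_neq0 // mul1r => /w_inj/eqP.
rewrite divff ?root_neq0 // (eq_bigr (fun=> 1)) => [|k _]; last exact: expr1n.
by rewrite sumr_const card_ord.
Qed.

(** The relation dual to [sum_expr_root_ratio]: for the square matrices
    [A = (w i ^+ k)] and [B = (n^-1 * w j ^- k)], one relation says
    [A *m B = 1], the other [B *m A = 1]. *)
Lemma sum_root_expr_ratio (k l : 'I_n) :
  \sum_j w j ^+ k / w j ^+ l = n%:R *+ (k == l).
Proof.
pose A := \matrix_(i < n, k < n) w i ^+ k.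
pose B := \matrix_(k < n, j < n) (n%:R^-1 * w j ^- k).
have /mulmx1C/matrixP/(_ l k) : A *m B = 1%:M.
  apply/matrixP=> i j; rewrite !mxE.
  under eq_bigr do rewrite !mxE mulrCA -expr_div_n.
  by rewrite -mulr_sumr sum_expr_root_ratio mulrnAr mulVf.
rewrite !mxE eq_sym; under eq_bigr do rewrite !mxE -mulrA.
rewrite -mulr_sumr => /(congr1 ( *%R n%:R)).
rewrite mulVKf // mulr_natr -mulrnA mulnC mulrnA => <-.
by apply: eq_bigr => j _; rewrite mulrC.
Qed.

Lemma root_fourier_inversion (t : nat -> F) (k : 'I_n) :
  \sum_j (n%:R^-1 * \sum_(l < n) t l / w j ^+ l) * w j ^+ k = t k.
Proof.
under eq_bigr do rewrite -mulrA mulr_suml.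
rewrite -mulr_sumr exchange_big /=.
under eq_bigr do under eq_bigr do rewrite mulrAC -mulrA.
under eq_bigr do rewrite -mulr_sumr sum_root_expr_ratio mulrnAr.
rewrite (bigD1 k) //= eqxx big1 => [|l /negPf]; last first.
  by rewrite eq_sym => ->.
by rewrite addr0 mulrCA mulVf ?mulr1.
Qed.

End RootFamily.

(** * Interpolation by polynomials bounded on the disk *)

Lemma normr_rootN1 (C : numClosedFieldType) (n : nat) (w : C) :
  (0 < n)%N -> w ^+ n = -1 -> `|w| = 1.
Proof.
move=> n_gt0 /(congr1 Num.norm); rewrite normrX normrN1 => /eqP.
by rewrite pexpr_eq1 // => /eqP.
Qed.

Section Interpolation.

Variables (C : numClosedFieldType) (n : nat) (w : 'I_n -> C).
Hypotheses (n_gt0 : (0 < n)%N) (w_inj : injective w).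
Hypothesis wn : forall j, w j ^+ n = -1.

Let n_neq0 : n%:R != 0 :> C. Proof. by rewrite pnatr_eq0 -lt0n. Qed.
Let N1_neq0 : -1 != 0 :> C. Proof. by rewrite oppr_eq0 oner_eq0. Qed.

(** The Dirichlet kernel in the variable [z / w j], normalised to be [1] at
    [w j].  On the unit circle its square is [(z / w j) ^+ (n - 1)] times the
    Fejer kernel. *)
Definition dirichlet_poly (j : 'I_n) : {poly C} :=
  \poly_(k < n) (n%:R^-1 / w j ^+ k).

Lemma dirichlet_polyE j z :
  (dirichlet_poly j).[z] = n%:R^-1 * \sum_(k < n) (z / w j) ^+ k.
Proof.
rewrite horner_poly mulr_sumr; apply: eq_bigr => k _.
by rewrite expr_div_n -mulrA [_^-1 * z ^+ k]mulrC.
Qed.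

Lemma dirichlet_poly_root i j : (dirichlet_poly j).[w i] = (i == j)%:R.
Proof.
by rewrite dirichlet_polyE (sum_expr_root_ratio _ N1_neq0) // mulrnAr mulVf.
Qed.

(** Parseval's identity for [dirichlet_poly j].[z] as a function of [j]. *)
Lemma sum_sqr_dirichlet_poly z :
  \sum_j `|(dirichlet_poly j).[z]| ^+ 2
    = n%:R^-1 * \sum_(k < n) (`|z| ^+ 2) ^+ k.
Proof.
have conjwV j : (w j)^-1^* = w j.
  by rewrite invC_norm (normr_rootN1 n_gt0 (wn j)) expr1n invr1 mul1r conjCK.
have conjnV : n%:R^-1^* = n%:R^-1 :> C by rewrite geC0_conj ?invr_ge0.
transitivity (\sum_j \sum_(k < n) \sum_(l < n)
    n%:R^-1 ^+ 2 * (z ^+ k * z^* ^+ l) * (w j ^+ l / w j ^+ k)).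
  apply: eq_bigr => j _; rewrite normCK dirichlet_polyE rmorphM /=.
  rewrite conjnV mulrACA -expr2 rmorph_sum mulr_suml mulr_sumr.
  apply: eq_bigr => k _; rewrite mulr_sumr mulr_sumr; apply: eq_bigr => l _.
  rewrite rmorphXn rmorphM /= conjwV expr_div_n exprMn.
  by rewrite -[RHS]mulrA; congr (_ * _); rewrite mulrACA [_^-1 * _]mulrC.
rewrite exchange_big mulr_sumr; apply: eq_bigr => k _.
rewrite exchange_big (bigD1 k) //= -mulr_sumr.
rewrite (sum_root_expr_ratio n_neq0 N1_neq0) // eqxx big1 => [|l].
  by rewrite addr0 -exprMn -normCK mulrAC expr2 divfK.
move=> /negPf neq_lk; rewrite -mulr_sumr.
by rewrite (sum_root_expr_ratio n_neq0 N1_neq0) // neq_lk mulr0.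
Qed.

(** The squares of the [dirichlet_poly j] interpolate, and their moduli add up
    to at most [1] on the closed disk, by Parseval. *)
Lemma bounded_interpolation (e : 'I_n -> C) : (forall j, `|e j| <= 1) ->
  exists f : {poly C}, [/\ (size f <= 2 * n - 1)%N,
    forall j, f.[w j] = e j & forall z, `|z| <= 1 -> `|f.[z]| <= 1].
Proof.
move=> e_le1; exists (\sum_j e j *: dirichlet_poly j ^+ 2); split.
- apply: (leq_trans (size_sum _ _ _)); apply/bigmax_leqP => j _.
  apply: (leq_trans (size_scale_leq _ _)).
  apply: (leq_trans (size_polyMleq _ _)).
  rewrite -subn1 mul2n -addnn leq_sub2r //.
  by apply: leq_add; apply: size_poly.
- move=> i; rewrite horner_sum (bigD1 i) //= big1 => [|j /negPf neq_ji].
    by rewrite addr0 hornerZ horner_exp dirichlet_poly_root eqxx expr1n mulr1.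
  by rewrite hornerZ horner_exp dirichlet_poly_root eq_sym neq_ji expr0n mulr0.
- move=> z z_le1; rewrite horner_sum.
  have z2_le1 : `|z| ^+ 2 <= 1 by rewrite exprn_ile1.
  apply: (le_trans (ler_norm_sum _ _ _)).
  apply: (le_trans (y := \sum_j `|(dirichlet_poly j).[z]| ^+ 2)).
    apply: ler_sum => j _; rewrite hornerZ horner_exp normrM normrX.
    by rewrite ler_piMl // exprn_ge0.
  rewrite sum_sqr_dirichlet_poly mulrC ler_pdivrMr ?ltr0n // mul1r.
  rewrite -[in leRHS](card_ord n) -sumr_const; apply: ler_sum => k _.
  by rewrite exprn_ile1 // exprn_ge0.
Qed.

End Interpolation.

(** * Boundary values *)

Lemma norm_horner_le_sum_coef (K : numDomainType) (p : {poly K}) (z : K) :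
  `|z| <= 1 -> `|p.[z]| <= \sum_(k < size p) `|p`_k|.
Proof.
move=> z_le1; rewrite horner_coef; apply: (le_trans (ler_norm_sum _ _ _)).
by apply: ler_sum => k _; rewrite normrM normrX ler_piMr // exprn_ile1.
Qed.

(** Write [f - f.[w] = q * ('X - w)]. Then [f] at [(1 - h) w] differs from
    [f.[w]] by at most [h] times a bound for [q] on the disk. *)
Lemma horner_boundary_le (K : numFieldType) (f : {poly K}) (b w : K) :
  (forall z, `|z| < 1 -> `|f.[z]| <= b) -> `|w| = 1 -> `|f.[w]| <= b.
Proof.
move=> f_le w1; have /factor_theorem[q Dq] : root (f - f.[w]%:P) w.
  by rewrite /root !hornerE subrr.
set M := \sum_(k < size q) `|q`_k|.
have M_ge0 : 0 <= M by apply: sumr_ge0.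
apply/ler_addgt0Pr => e e_gt0.
(* [h <= 1] keeps [(1 - h) * w] in the disk, [h * M <= e] bounds the error *)
have [h [h_gt0 h_le1 hM]] : exists h, [/\ 0 < h, h <= 1 & h * M <= e].
  have D_gt0 : 0 < e + M + 1 by rewrite addr_gt0 // ltr_wpDr.
  exists (e / (e + M + 1)); split; first by rewrite divr_gt0.
    by rewrite ler_pdivrMr // mul1r -addrA lerDl addr_ge0.
  rewrite mulrAC ler_pdivrMr // ler_pM2l // addrAC lerDr.
  by rewrite addr_ge0 // ltW.
pose z := (1 - h) * w.
have z_lt1 : `|z| < 1.
  by rewrite normrM w1 mulr1 ger0_norm ?subr_ge0 // gtrBl.
have -> : f.[w] = f.[z] + q.[z] * (h * w).
  have <- : w - z = h * w by rewrite /z mulrBl mul1r subKr.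
  move/(congr1 (horner^~ z)): Dq; rewrite /= hornerM hornerXsubC.
  rewrite hornerD hornerN hornerC -(opprB w z) -[LHS]opprB mulrN.
  by move/oppr_inj <-; rewrite addrC subrK.
apply: (le_trans (ler_normD _ _)); apply: lerD; first exact: f_le.
apply: le_trans hM; rewrite !normrM w1 mulr1 (gtr0_norm h_gt0) mulrC.
by rewrite ler_wpM2l ?(ltW h_gt0) // norm_horner_le_sum_coef // ltW.
Qed.

Lemma disk_supnorm_le1P (R : realType) (f : R[i] -> R[i]) :
  (disk_supnorm f <= 1%:E)%E <-> forall z, `|z| < 1 -> `|f z| <= 1.
Proof.
have Re_le1 z : (`|f z| <= 1) = (complex.Re `|f z| <= 1).
  by rewrite normc_def lecE /= eqxx.
split=> [f_le1 z z_lt1 | f_le1].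
  rewrite Re_le1 -lee_fin; apply: le_trans f_le1.
  by apply: ereal_sup_ubound; exists z.
by apply: ge_ereal_sup => _ [z z_lt1 <-]; rewrite lee_fin -Re_le1 f_le1.
Qed.

(** * The linear functional *)

(** Fourier inversion gives the case [nu < n]; both sides change sign when [nu]
    grows by [n], so it extends to all [nu]. *)
Lemma antiperiodic_fourier (C : numClosedFieldType) (n : nat) (w : 'I_n -> C)
    (t : nat -> C) :
    (0 < n)%N -> injective w -> (forall j, w j ^+ n = -1) ->
    (forall nu, t (n + nu)%N = - t nu) ->
  forall nu,
    t nu = \sum_j (n%:R^-1 * \sum_(l < n) t l / w j ^+ l) * w j ^+ nu.
Proof.
move=> n_gt0 w_inj wn tn; elim/ltn_ind=> nu IHnu.
case: (ltnP nu n) => [lt_nu | le_nu].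
  rewrite -[in LHS](root_fourier_inversion (c := -1) _ _ w_inj wn t
    (Ordinal lt_nu)) // ?oppr_eq0 ?oner_eq0 //.
  by rewrite pnatr_eq0 -lt0n.
rewrite -(subnKC le_nu) tn IHnu ?ltn_subrL ?n_gt0 ?(leq_trans n_gt0) //.
by rewrite -sumrN; apply: eq_bigr => j _; rewrite exprD wn mulN1r mulrN.
Qed.

Lemma sum_coef_fourier (C : comNzRingType) (n d : nat) (w c : 'I_n -> C)
    (t : nat -> C) (f : {poly C}) :
    (forall nu, t nu = \sum_j c j * w j ^+ nu) -> (size f <= d)%N ->
  \sum_(0 <= nu < d) t nu * f`_nu = \sum_j c j * f.[w j].
Proof.
move=> tE le_fd; rewrite big_mkord.
under eq_bigr do rewrite tE mulr_suml.
rewrite exchange_big; apply: eq_bigr => j _.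
rewrite (horner_coef_wide _ le_fd) mulr_sumr; apply: eq_bigr => nu _.
by rewrite -mulrA [w j ^+ nu * _]mulrC.
Qed.

Lemma Zp_antiperiodic (V : zmodType) (n : nat) (t : 'Z_(2 * n) -> V) :
    (0 < n)%N -> (forall nu, (nu < n)%N -> t (n + nu)%:R = - t nu%:R) ->
  forall nu, t (n + nu)%:R = - t nu%:R.
Proof.
move=> n_gt0 ht nu; have gt1_2n : (1 < 2 * n)%N.
  by rewrite mul2n -addnn; apply: (leq_add n_gt0).
have t_mod m : t m%:R = t (m %% (2 * n))%:R by rewrite Zp_nat_mod.
have lt_r : (nu %% (2 * n) < 2 * n)%N by rewrite ltn_mod ltnW.
rewrite t_mod -modnDmr -t_mod [t nu%:R]t_mod.
move: (nu %% _)%N lt_r => r lt_r.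
case: (ltnP r n) => [/ht // | le_nr].
have lt_rn : (r - n < n)%N by rewrite ltn_subLR // addnn -mul2n.
rewrite -(subnKC le_nr) (ht _ lt_rn) opprK addnA addnn -mul2n.
by rewrite t_mod modnDl -t_mod.
Qed.

Lemma fsbig_codom (V : nmodType) (I : finType) (T : choiceType) (w : I -> T)
    (A : set T) (F : T -> V) :
    injective w -> (forall x, A x <-> exists j, x = w j) ->
  \sum_(x \in A) F x = \sum_j F (w j).
Proof.
move=> w_inj AP; rewrite -(big_map w xpredT F) [RHS]fsbig_seq; last first.
  by rewrite map_inj_uniq ?index_enum_uniq.
suff -> : A = [set` map w (index_enum I)] by [].
apply/seteqP; split=> x /=; rewrite AP.
  by case=> j ->; apply/mapP; exists j; rewrite ?mem_index_enum.
by case/mapP=> j _ ->; exists j.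
Qed.

Theorem theorem2p5 (R : realType) (n d : nat)
    (n_gt0 : (0 < n)%N) (d_gt0 : (0 < d)%N) (hd : (2 * n - 1 <= d)%N)
    (t : 'Z_(2 * n) -> R[i])
    (ht : forall nu : nat, (nu < n)%N -> t (n + nu)%:R = - t nu%:R) :
  (forall f : {poly R[i]}, (size f <= d)%N ->
     (disk_supnorm (fun z => f.[z]) <= 1%:E)%E ->
     `|\sum_(0 <= nu < d) t nu%:R * f`_nu| <=
       n%:R^-1 * \sum_(w \in [set w : R[i] | w ^+ n = -1])
                   `|\sum_(0 <= nu < n) t nu%:R / w ^+ nu|) /\
  (exists f : {poly R[i]},
     [/\ (size f <= d)%N,
         (size f <= 2 * n - 1)%N,
         (disk_supnorm (fun z => f.[z]) <= 1%:E)%E &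
         `|\sum_(0 <= nu < d) t nu%:R * f`_nu| =
           n%:R^-1 * \sum_(w \in [set w : R[i] | w ^+ n = -1])
                       `|\sum_(0 <= nu < n) t nu%:R / w ^+ nu| ]).
Proof.
have [w w_inj wP] := roots_XnD1 R[i] n_gt0.
have wn j : w j ^+ n = -1 by apply/wP; exists j.
pose c j := n%:R^-1 * \sum_(l < n) t l%:R / w j ^+ l.
have tE := antiperiodic_fourier (t := fun nu => t nu%:R) n_gt0 w_inj wn
  (Zp_antiperiodic n_gt0 ht).
have -> : n%:R^-1 * \sum_(w \in [set w : R[i] | w ^+ n = -1])
    `|\sum_(0 <= nu < n) t nu%:R / w ^+ nu| = \sum_j `|c j|.
  rewrite (fsbig_codom _ w_inj wP) mulr_sumr; apply: eq_bigr => j _.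
  by rewrite normrM ger0_norm ?invr_ge0 // big_mkord.
split=> [f le_fd /disk_supnorm_le1P f_le1 | ].
  rewrite (sum_coef_fourier tE le_fd).
  apply: (le_trans (ler_norm_sum _ _ _)); apply: ler_sum => j _.
  rewrite normrM ler_piMr //; apply: horner_boundary_le => //.
  exact: normr_rootN1 (wn j).
(* [c j] times the prescribed value is [`|c j|]; if [c j = 0], that value is
   [0 / 0 = 0], of modulus at most [1] as required *)
have [|f [size_f fw f_le1]] :=
  bounded_interpolation n_gt0 w_inj wn (e := fun j => `|c j| / c j).
  move=> j; rewrite normf_div normr_id.
  by case: (eqVneq `|c j| 0) => [->|?]; rewrite ?mul0r ?divff.
exists f; split=> //; first exact: leq_trans hd.
  by apply/disk_supnorm_le1P => z /ltW/f_le1.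
rewrite (sum_coef_fourier tE (leq_trans size_f hd)).
rewrite (eq_bigr (fun j => `|c j|)) => [|j _].
  by rewrite ger0_norm // sumr_ge0.
rewrite fw -/(c j); case: (eqVneq (c j) 0) => [->|c_neq0].
  by rewrite normr0 !mul0r.
by rewrite mulrC divfK.
Qed.
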